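(* Let $n\ge 4$ and let $\mathbf z=(z_\alpha)_{\alpha\in I_n}$ be a Heronian frieze of order $n$ such that $z_{(i,j)}\neq 0$ for every $(i,j)\in\mathbb Z^2$ with $2\le j-i\le n-2$. Let $\pi$ be any traversing path. Then the entire frieze $\mathbf z$ is uniquely determined by its entries lying on $\pi$; that is, if $\mathbf z'$ is another Heronian frieze of order $n$ satisfying the same nonvanishing condition and $z'_\alpha=z_\alpha$ for all indices $\alpha$ in $\pi$, then $\mathbf z'=\mathbf z$.
   Context: For complex $p,q,r$ put $H(p,q,r)=-p^2-q^2-r^2+2pq+2pr+2qr$. A Heronian diamond is an ordered 10-tuple $(a,b,c,d,e,f,p,q,r,s)$ of complex numbers satisfying $p^2=H(b,c,e)$, $q^2=H(a,d,e)$, $r^2=H(a,f,b)$, $s^2=H(c,f,d)$, $r+s=p+q$, $4ef=(p+q)^2+(a-b+c-d)^2$, and $e(r-s)=p(a-d)+q(b-c)$. Index sets, for $n\ge4$: $N_n=\{(i,j)\in(\mathbb Z\times\frac12\mathbb Z)\cup(\frac12\mathbb Z\times\mathbb Z): 0\le j-i\le n\}$ (nodes); $L_n=\{(i+\frac12,/): i\in\mathbb Z\}\cup\{(\backslash,j+\frac12): j\in\mathbb Z\}$ (formal indices called lines); $I_n=N_n\sqcup L_n$. Nodes with $1\le j-i\le n-1$ are called interior. A Heronian frieze of order $n$ is an array $\mathbf z=(z_\alpha)_{\alpha\in I_n}$ of complex numbers such that (1) for every $(i,j)\in\mathbb Z^2$ with $1\le j-i\le n-1$ the 10-tuple $$(z_{(i,j+1)},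 z_{(i+\frac12,/)}, z_{(i+1,j)}, z_{(\backslash,j+\frac12)}, z_{(i,j)}, z_{(i+1,j+1)}, z_{(i+\frac12,j)}, z_{(i,j+\frac12)}, z_{(i+\frac12,j+1)}, z_{(i+1,j+\frac12)})$$ is a Heronian diamond (in the order $(a,b,c,d,e,f,p,q,r,s)$); and (2) $z_{(i,j)}=0$ for every $(i,j)\in N_n$ with $j-i\in\{0,\frac12,n-\frac12,n\}$. A traversing path (for order $n$) is an ordered collection $\pi=((i_1,j_1),\dots,(i_{2n-3},j_{2n-3}),\ell_1,\dots,\ell_{n-2})$ of $3n-5$ indices in $I_n$ such that: the $(i_k,j_k)$ are interior nodes of $N_n$; the $\ell_k$ are lines in $L_n$; $j_1-i_1=1$; $j_{2n-3}-i_{2n-3}=n-1$; $|i_{k+1}-i_k|+|j_{k+1}-j_k|=\frac12$ for $1\le k\le 2n-4$; if $i_{2k}\in\mathbb Z+\frac12$ then $\ell_k=(i_{2k},/)$; if $j_{2k}\in\mathbb Z+\frac12$ then $\ell_k=(\backslash,j_{2k})$. (So the nodes form a shortest lattice path, with half-integer steps, from the row $j-i=1$ to the row $j-i=n-1$.) *)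

(* Defs.v *)
From HB Require Import structures.
From mathcomp Require Import all_boot all_order all_algebra.
From mathcomp Require Import reals complex.

Set Implicit Arguments.
Unset Strict Implicit.
Unset Printing Implicit Defensive.

Import Order.TTheory GRing.Theory Num.Theory.
Local Open Scope ring_scope.

(* The complex numbers are [R[i]] for a [R : realType]. *)

Definition heronH (R : realType) (p q r : R[i]) : R[i] :=
  - p ^+ 2 - q ^+ 2 - r ^+ 2 + 2 * p * q + 2 * p * r + 2 * q * r.

Definition heronian_diamond (R : realType)
    (a b c d e f p q r s : R[i]) : Prop :=
  [/\ [/\ p ^+ 2 = heronH b c e, q ^+ 2 = heronH a d e,
          r ^+ 2 = heronH a f b & s ^+ 2 = heronH c f d],
      r + s = p + q,
      4 * e * f = (p + q) ^+ 2 + (a - b + c - d) ^+ 2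
    & e * (r - s) = p * (a - d) + q * (b - c)].

(* x \in (1/2)Z, as opposed to x \in Z + 1/2 for [half_odd]. *)
Definition int_or_half (x : rat) : bool := 2 * x \is a Num.int.

Definition half_odd (x : rat) : bool := x - 1 / 2 \is a Num.int.

(* [Node i j], [Slash x] and [Backslash x] stand for (i, j), (x, /) and
   (\, x).  The type is larger than the index set I_n, which is carved out by
   [frieze_index n]; arrays indexed by I_n are represented by functions on
   [array_index], whose values outside I_n are irrelevant. *)
Inductive array_index : Type :=
  | Node of rat & rat
  | Slash of rat
  | Backslash of rat.

Definition is_node (n : nat) (i j : rat) : bool :=
  ((i \is a Num.int) && int_or_half j || int_or_half i && (j \is a Num.int))
  && (0 <= j - i <= n%:R).

Definition interior_node (n : nat) (i j : rat) : bool :=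
  is_node n i j && (1 <= j - i <= n%:R - 1).

Definition is_line (x : array_index) : bool :=
  match x with
  | Node _ _ => false
  | Slash i => half_odd i
  | Backslash j => half_odd j
  end.

Definition frieze_index (n : nat) (x : array_index) : bool :=
  match x with
  | Node i j => is_node n i j
  | _ => is_line x
  end.

Definition heronian_frieze (R : realType) (n : nat) (z : array_index -> R[i]) : Prop :=
  (forall i0 j0 : int, 1 <= j0 - i0 <= n%:Z - 1 ->
     let i : rat := i0%:~R in
     let j : rat := j0%:~R in
     heronian_diamond
       (z (Node i (j + 1))) (z (Slash (i + 1 / 2)))
       (z (Node (i + 1) j)) (z (Backslash (j + 1 / 2)))
       (z (Node i j)) (z (Node (i + 1) (j + 1)))
       (z (Node (i + 1 / 2) j)) (z (Node i (j + 1 / 2)))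
       (z (Node (i + 1 / 2) (j + 1))) (z (Node (i + 1) (j + 1 / 2)))) /\
  (forall i j : rat, is_node n i j ->
     j - i \in [:: 0; 1 / 2; n%:R - 1 / 2; n%:R] -> z (Node i j) = 0).

Definition nonvanishing (R : realType) (n : nat) (z : array_index -> R[i]) : Prop :=
  forall i j : int, 2 <= j - i <= n%:Z - 2 -> z (Node i%:~R j%:~R) != 0.

(* A path is given by its node coordinates [i k], [j k] for k = 1, ..., 2n-3
   and its lines [l k] for k = 1, ..., n-2; the values of the three sequences
   at other k are irrelevant. *)
Definition traversing_path (n : nat) (i j : nat -> rat) (l : nat -> array_index) :
    Prop :=
  [/\ forall k, (1 <= k <= 2 * n - 3)%N -> interior_node n (i k) (j k),
      forall k, (1 <= k <= n - 2)%N -> is_line (l k),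
      j 1%N - i 1%N = 1 /\ j (2 * n - 3)%N - i (2 * n - 3)%N = n%:R - 1,
      forall k, (1 <= k <= 2 * n - 4)%N ->
        `|i k.+1 - i k| + `|j k.+1 - j k| = 1 / 2
    & forall k, (1 <= k <= n - 2)%N ->
        (half_odd (i (2 * k)%N) -> l k = Slash (i (2 * k)%N)) /\
        (half_odd (j (2 * k)%N) -> l k = Backslash (j (2 * k)%N))].

Definition on_path (n : nat) (i j : nat -> rat) (l : nat -> array_index)
    (x : array_index) : Prop :=
  (exists2 k, (1 <= k <= 2 * n - 3)%N & x = Node (i k) (j k)) \/
  (exists2 k, (1 <= k <= n - 2)%N & x = l k).

(* Main.v *)
(** When e <> 0, the entries f, r, s of a Heronian diamond are polynomial in the
    others divided by e.  The reflection exchanging e with f, a with c, p with r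
    and q with s preserves such diamonds, so f <> 0 recovers e, p, q in turn.  In
    the rows j - i = 1 and j - i = n - 1, where e may vanish, the zero boundary
    forces the two line entries to equal e and f, and propagation still works.
    The nodes of a traversing path join consecutive integer points (I, J) by
    unit steps decreasing I or increasing J; the values on it spread to all
    points on its right, by induction along the order J, then I, and to all
    points on its left by the symmetry (I, J) -> (-J, -I). *)
Require Import Defs.
From HB Require Import structures.
From mathcomp Require Import all_boot all_order all_algebra.
From mathcomp Require Import reals complex.
From mathcomp Require Import zify ring lra.

Set Implicit Arguments.
Unset Strict Implicit.
Unset Printing Implicit Defensive.

Import Order.TTheory GRing.Theory Num.Theory.
Local Open Scope ring_scope.

(** * Algebra of a single Heronian diamond *)

Lemma pnatr_neq0 (R : realType) k : k.+1%:R != 0 :> R[i].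
Proof. by rewrite pnatr_eq0. Qed.

(* The last two cases are those of the rows j - i = 1 and j - i = n - 1. *)
Definition flippable (R : realType) (a c e f p q r s : R[i]) : Prop :=
  [\/ e != 0 /\ f != 0, [/\ c = 0, p = 0 & s = 0] | [/\ a = 0, q = 0 & r = 0]].

(** Here [heronH x 0 y] is [- (x - y) ^+ 2]. *)
Lemma heronH0 (R : realType) (x y : R[i]) : 0 ^+ 2 = heronH x 0 y -> x = y.
Proof.
rewrite /heronH => h; apply/eqP; rewrite -subr_eq0 -sqrf_eq0; apply/eqP.
have -> : (x - y) ^+ 2 = - 0 ^+ 2 by rewrite h; ring.
by rewrite expr0n oppr0.
Qed.

Lemma heronHC12 (R : realType) (x y w : R[i]) : heronH x y w = heronH y x w.
Proof. by rewrite /heronH; ring. Qed.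

Lemma diamond_bottom (R : realType) (a b d e f q r : R[i]) :
  heronian_diamond a b 0 d e f 0 q r 0 -> [/\ b = e, d = f & r = q].
Proof.
case=> [[hp _ _ hs] hrs _ _]; split; first exact: heronH0 hp.
  by apply/esym/heronH0; rewrite heronHC12.
by move: hrs; rewrite addr0 add0r.
Qed.

Lemma diamond_top (R : realType) (b c d e f p s : R[i]) :
  heronian_diamond 0 b c d e f p 0 0 s -> [/\ d = e, b = f & s = p].
Proof.
case=> [[_ hq hr _] hrs _ _]; split.
- by apply: heronH0; rewrite heronHC12.
- by apply/esym/heronH0; rewrite heronHC12.
by move: hrs; rewrite addr0 add0r.
Qed.

(** Only the last equation, [f * (p - q) = r * (c - d) + s * (b - a)], takes work: in the two
    boundary cases it follows from the forced entries, otherwise it is checked after multiplication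
    by [4 * e]. *)
Lemma diamond_flip (R : realType) (a b c d e f p q r s : R[i]) :
  flippable a c e f p q r s ->
  heronian_diamond a b c d e f p q r s -> heronian_diamond c b a d f e r s p q.
Proof.
move=> flip dia; have [[hp hq hr hs] hrs hef he] := dia.
split.
- by split; rewrite ?hp ?hq ?hr ?hs /heronH; ring.
- by rewrite hrs.
- by rewrite mulrAC hef hrs; ring.
case: flip => [[e0 _]|[c0 p0 s0]|[a0 q0 r0]]; last 2 first.
- by subst c p s; have [-> -> ->] := diamond_bottom dia; ring.
- by subst a q r; have [-> -> ->] := diamond_top dia; ring.
have e4 : 4 * e != 0 by rewrite mulf_neq0 ?pnatr_neq0.
apply: (mulfI e4).
(* The right side involves [r] and [s] only through [e * (r + s)] and [e * (r - s)], both given by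
   the diamond equations. *)
have h2 : 4 * e * (r * (c - d) + s * (b - a)) =
    2 * (e * (r + s) * (c - d + b - a) + e * (r - s) * (c - d - b + a)) by ring.
rewrite mulrA hef h2 hrs he.
(* Trading [p ^+ 2 - q ^+ 2] for Heron values leaves an identity linear in [p] and [q]. *)
have hsq : p ^+ 2 - q ^+ 2 = heronH b c e - heronH a d e by rewrite hp hq.
have -> : ((p + q) ^+ 2 + (a - b + c - d) ^+ 2) * (p - q) =
  (p + q) * (p ^+ 2 - q ^+ 2) + (p - q) * (a - b + c - d) ^+ 2 by ring.
by rewrite hsq /heronH; ring.
Qed.

Lemma flippable_sym (R : realType) (a c e f p q r s : R[i]) :
  flippable a c e f p q r s -> flippable c a f e r s p q.
Proof.
case=> [[e0 f0]|[c0 p0 s0]|[a0 q0 r0]];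
  [by constructor 1|by constructor 3|by constructor 2].
Qed.

Lemma diamond_determined (R : realType) (a b c d e f p q r s f' r' s' : R[i]) :
  flippable a c e f p q r s -> flippable a c e f' p q r' s' ->
  heronian_diamond a b c d e f p q r s ->
  heronian_diamond a b c d e f' p q r' s' -> [/\ f' = f, r' = r & s' = s].
Proof.
move=> flip flip' dia dia'.
have gen : e != 0 -> [/\ f' = f, r' = r & s' = s].
  have [_ hrs hef he] := dia; have [_ hrs' hef' he'] := dia'.
  move=> e0; have e4 : 4 * e != 0 by rewrite mulf_neq0 ?pnatr_neq0.
  have ef : f' = f by apply: (mulfI e4); rewrite hef hef'.
  have er : r' - s' = r - s by apply: (mulfI e0); rewrite he he'.
  have es : r' + s' = r + s by rewrite hrs hrs'.
  have err : r' = r.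
    apply: (mulfI (pnatr_neq0 R 1)).
    have -> : 2 * r' = (r' + s') + (r' - s') by ring.
    by rewrite er es; ring.
  by split=> //; apply: (addrI r); rewrite -[in LHS]err.
(* The two tuples may be flippable for different reasons, so mixed cases occur. *)
case: flip => [[/gen]//|[c0 p0 s0]|[a0 q0 r0]]; subst;
  case: flip' => [[/gen]//|[? ? ?]|[? ? ?]]; subst.
- have [eb ed er] := diamond_bottom dia; have [eb' ed' er'] := diamond_bottom dia'.
  by split; congruence.
- have [eb ed er] := diamond_bottom dia; have [ed' eb' es'] := diamond_top dia'.
  by split; congruence.
- have [ed eb es] := diamond_top dia; have [eb' ed' er'] := diamond_bottom dia'.
  by split; congruence.
have [ed eb es] := diamond_top dia; have [ed' eb' es'] := diamond_top dia'.
by split; congruence.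
Qed.

(** * Propagation from a lattice path by flips *)

(* [A I J] is meant for the point (I, J), [U I J] for the edge between (I, J)
   and (I - 1, J), [D I J] for the edge between (I, J) and (I, J - 1). *)
Record flip_closed (n : int) (A U D : int -> int -> Prop) : Prop := FlipClosed {
  flip_right : forall I J : int, 1 <= J - I <= n - 1 ->
    A I J -> A I (J + 1) -> A (I + 1) J -> U (I + 1) J -> D I (J + 1) ->
    [/\ A (I + 1) (J + 1), U (I + 1) (J + 1) & D (I + 1) (J + 1)];
  flip_left : forall I J : int, 1 <= J - I <= n - 1 ->
    A (I + 1) (J + 1) -> A I (J + 1) -> A (I + 1) J ->
    U (I + 1) (J + 1) -> D (I + 1) (J + 1) ->
    [/\ A I J, U (I + 1) J & D I (J + 1)];
  border0 : forall I : int, A I I;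
  bordern : forall I : int, A I (I + n);
  border1 : forall I : int, A I (I + 1) -> U (I + 1) (I + 1) /\ D I (I + 1);
  bordern1 : forall I : int, A I (I + n - 1) -> U I (I + n - 1) /\ D I (I + n) }.

(* The path has exactly one point (m k - k, m k) in each row J - I = k. *)
Record lattice_path (n : int) (A U D : int -> int -> Prop) (m : int -> int) : Prop :=
  LatticePath {
  path_point : forall k : int, 0 <= k <= n -> A (m k - k) (m k);
  path_step : forall k : int, 0 <= k <= n - 1 ->
    (m (k + 1) = m k /\ U (m k - k) (m k)) \/
    (m (k + 1) = m k + 1 /\ D (m k - k) (m k + 1)) }.

Section LatticeClosure.

Context (n : int) (n_gt1 : 1 < n).

(** The premises on [U I J] and [D I J] say that the other end of the edge, in row [J - I + 1] or
    [J - I - 1], is also on the path or to its right. *)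
Lemma path_right (A U D : int -> int -> Prop) (m : int -> int) :
  flip_closed n A U D -> lattice_path n A U D m ->
  forall I J : int, 0 <= J - I <= n -> m (J - I) <= J ->
  [/\ A I J, J - I < n -> m (J - I + 1) <= J -> U I J
    & 0 < J - I -> m (J - I - 1) <= J - 1 -> D I J].
Proof.
move=> [flip _ b0 bn b1 bn1] [pA pS].
have step (k : int) : 0 <= k <= n - 1 -> m k <= m (k + 1) <= m k + 1.
  by move=> /pS [[-> _]|[-> _]]; lia.
have m0 (k : nat) : k%:Z <= n -> m 0 <= m k%:Z.
  elim: k => [|k IH] hk //.
  have := step k; have -> : k%:Z + 1 = k.+1%:Z by lia.
  by move: IH; lia.
(* [n * J + I] encodes the lexicographic order on (J, I): a flip at (I, J) uses
   (I - 1, J), (I - 1, J - 1) and (I, J - 1). *)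
have key (w : nat) : forall I J : int, 0 <= J - I <= n -> m (J - I) <= J ->
    n * J + I < (n + 1) * m 0 - n + w%:Z ->
  [/\ A I J, J - I < n -> m (J - I + 1) <= J -> U I J
    & 0 < J - I -> m (J - I - 1) <= J - 1 -> D I J]; last first.
  move=> I J h1 h2.
  apply: (key (absz (n * J + I - ((n + 1) * m 0 - n) + 1)) I J h1 h2).
  by lia.
(* No key lies below the starting bound: [m 0 <= m (J - I) <= J] and [J - n <= I] give
   [(n + 1) * m 0 - n <= n * J + I]. *)
elim: w => [|w IH] I J hk hm hw.
  have := m0 `|J - I|%N; have -> : `|J - I|%N%:Z = J - I by lia.
  by move: hk hm hw; nia.
have nJ : n * (J - 1) = n * J - n by ring.
have [/eqP k0|k0] := boolP (J - I == 0).
  have eI : I = J by lia.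
  subst I; split; [exact: b0 | move=> _ hm1 | by lia].
  have [] := IH (J - 1) J; [lia | | lia |].
    by have -> : J - (J - 1) = J - J + 1 by ring.
  move=> aJ _ _; have [] := b1 (J - 1); first by rewrite subrK.
  by rewrite subrK.
have [/eqP kn|kn] := boolP (J - I == n).
  have eJ : J = I + n by lia.
  subst J; split; [exact: bn | by lia | move=> _ hm1].
  have [] := IH I (I + n - 1); [lia | | lia |].
    by have -> : I + n - 1 - I = I + n - I - 1 by ring.
  by move=> aJ _ _; have [] := bn1 I aJ.
(* At a point of the path, an edge whose other end is not to the left must be a step of the path
   itself. *)
have [eJ|nJm] := eqVneq (m (J - I)) J.
  have eI : m (J - I) - (J - I) = I by lia.
  split.
  - by have := pA (J - I); rewrite eI eJ; apply; lia.
  - move=> _ hm1; have [|[_]|[e1 _]] := pS (J - I); [lia| |lia].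
    by rewrite eI eJ.
  move=> _ hm1; have [|[e1 _]|[e1]] := pS (J - I - 1); [lia| |].
    by rewrite subrK in e1; lia.
  rewrite subrK in e1; have -> : m (J - I - 1) - (J - I - 1) = I by lia.
  by rewrite -e1 eJ.
(* Now [m (J - I) <= J - 1]. As [m] grows by 0 or 1 per row, the other three corners of the diamond
   and the two edges needed for the flip are not to the left of the path. *)
have s1 := step (J - I); have s2 := step (J - I - 1).
rewrite subrK in s2.
have ek : J - 1 - (I - 1) = J - I by ring.
have ek1 : J - (I - 1) = J - I + 1 by ring.
have ek2 : J - 1 - I = J - I - 1 by ring.
have [Ae _ _] : [/\ A (I - 1) (J - 1), True & True].
  by have [] := IH (I - 1) (J - 1); rewrite ?ek //; lia.
have [Aa Da] : A (I - 1) J /\ D (I - 1) J.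
  have [] := IH (I - 1) J; rewrite ?ek1 ?addrK; [lia..|move=> ? _ h].
  by split=> //; apply: h; lia.
have [Ac Uc] : A I (J - 1) /\ U I (J - 1).
  have [] := IH I (J - 1); rewrite ?ek2 ?subrK; [lia..|move=> ? h _].
  by split=> //; apply: h; lia.
by have [] := flip (I - 1) (J - 1); rewrite ?subrK //; lia.
Qed.

(** The reflection keeps each row and swaps the two flips and the two kinds of edges. The shifts by
    1 arise because an edge is named after its end with the larger coordinate, which becomes the
    smaller one. *)
Lemma flip_closed_reflect (A U D : int -> int -> Prop) :
  flip_closed n A U D ->
  flip_closed n (fun I J => A (- J) (- I)) (fun I J => D (- J) (- I + 1))
    (fun I J => U (- J + 1) (- I)).
Proof.
move=> [fr fl b0 bn b1 bn1]; split.
- move=> I J hk; have hk' : 1 <= (- I - 1) - (- J - 1) <= n - 1 by lia.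
  have := fl _ _ hk'; rewrite !opprD !subrK => h A1 A2 A3 U1 D1.
  by have [] := h A1 A2 A3 D1 U1.
- move=> I J hk; have hk' : 1 <= (- I - 1) - (- J - 1) <= n - 1 by lia.
  have := fr _ _ hk'; rewrite !opprD !subrK => h A1 A2 A3 U1 D1.
  by have [] := h A1 A2 A3 D1 U1.
- by move=> I; apply: b0.
- by move=> I; have := bn (- (I + n)); rewrite opprD subrK.
- move=> I; have := b1 (- (I + 1)); rewrite opprD subrK => h /h[h1 h2].
  by split.
move=> I; have := bn1 (- (I + n - 1)).
have -> : - (I + n - 1) + n - 1 = - I by ring.
have -> : - (I + n - 1) + n = - I + 1 by ring.
have -> : - (I + n) + 1 = - (I + n - 1) by ring.
by move=> h /h[h1 h2]; split.
Qed.

Lemma lattice_path_reflect (A U D : int -> int -> Prop) (m : int -> int) :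
  lattice_path n A U D m ->
  lattice_path n (fun I J => A (- J) (- I)) (fun I J => D (- J) (- I + 1))
    (fun I J => U (- J + 1) (- I)) (fun k => k - m k).
Proof.
move=> [pA pS]; split=> k hk.
  have -> : - (k - m k) = m k - k by ring.
  have -> : - (k - m k - k) = m k by ring.
  exact: pA.
have -> : - (k - m k - k) = m k by ring.
have -> : - (k - m k) = m k - k by ring.
have -> : - (k - m k + 1) + 1 = m k - k by ring.
by case: (pS k hk) => -[-> h]; [right | left]; split => //; ring.
Qed.

(** Points of the path count for both sides, and no edge straddles the path because [m] grows by 0
    or 1 per row. *)
Lemma flip_closed_path_full (A U D : int -> int -> Prop) (m : int -> int) :
  flip_closed n A U D -> lattice_path n A U D m ->
  [/\ forall I J : int, 0 <= J - I <= n -> A I J,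
      forall I J : int, 0 <= J - I < n -> U I J
    & forall I J : int, 0 < J - I <= n -> D I J].
Proof.
move=> fc lp.
have rt := path_right fc lp.
have lt := path_right (flip_closed_reflect fc) (lattice_path_reflect lp).
have step (k : int) : 0 <= k <= n - 1 -> m k <= m (k + 1) <= m k + 1.
  by move=> /(path_step lp) [[-> _]|[-> _]]; lia.
have ek (I J : int) : - I - - J = J - I :> int by ring.
split=> I J hk.
- have [hm|hm] := leP (m (J - I)) J; first by have [] := rt I J hk hm.
  by have := lt (- J) (- I); rewrite ek !opprK => h; have [||] := h; lia || by [].
- have s := step (J - I).
  have [hm|hm] := leP (m (J - I + 1)) J.
    by have [||_ h _] := rt I J; [lia..|apply: h => //; lia].
  have := lt (- J) (- I + 1).
  have -> : - I + 1 - - J = J - I + 1 by ring.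
  rewrite addrK !opprK opprD subrK opprK => h; have [||_ _] := h; [lia..|].
  by apply; lia.
have s := step (J - I - 1); rewrite subrK in s.
have [hm|hm] := boolP ((m (J - I) <= J) && (m (J - I - 1) <= J - 1)).
  by have [||_ _ h] := rt I J; [lia..|apply: h; lia].
have := lt (- J + 1) (- I).
have -> : - I - (- J + 1) = J - I - 1 by ring.
rewrite subrK !opprK opprD subrK opprK => h; have [||_ + _] := h; [lia..|].
by apply; lia.
Qed.

End LatticeClosure.

(** * Integer coordinates on the index set *)

Definition point (I J : int) : array_index := Node I%:~R J%:~R.
(** Half-integers are written as an integer minus 1/2, so that this node and [down_node I J] are the
    midpoints of the edges meant by [U I J] and [D I J]. *)
Definition up_node (I J : int) : array_index := Node (I%:~R - 1 / 2) J%:~R.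
Definition down_node (I J : int) : array_index := Node I%:~R (J%:~R - 1 / 2).
Definition slash (I : int) : array_index := Slash (I%:~R - 1 / 2).
Definition backslash (J : int) : array_index := Backslash (J%:~R - 1 / 2).

Lemma half_odd_int_subr (I : int) : half_odd (I%:~R - 1 / 2).
Proof.
rewrite /half_odd; have -> : I%:~R - 1 / 2 - 1 / 2 = (I - 1)%:~R :> rat.
  by rewrite intrB; field.
exact: intr_int.
Qed.

Lemma half_oddP (x : rat) : half_odd x -> exists I : int, x = I%:~R - 1 / 2.
Proof.
rewrite /half_odd => /intrP[m hm]; exists (m + 1).
by rewrite intrD -hm; field.
Qed.

Lemma int_or_half_int (I : int) : int_or_half I%:~R.
Proof. by rewrite /int_or_half -(intrM _ 2) intr_int. Qed.

Lemma int_or_half_half (I : int) : int_or_half (I%:~R - 1 / 2).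
Proof.
rewrite /int_or_half; have -> : 2 * (I%:~R - 1 / 2) = (2 * I - 1)%:~R :> rat.
  by rewrite intrB intrM; field.
exact: intr_int.
Qed.

Lemma int_or_halfP (x : rat) : int_or_half x ->
  exists I : int, x = I%:~R \/ x = I%:~R - 1 / 2.
Proof.
rewrite /int_or_half => /intrP[m hm].
have -> : x = m%:~R / 2 by rewrite -hm; field.
have [k [->|->]] : exists k : int, m = 2 * k \/ m = 2 * k - 1.
  by exists ((m + 1) %/ 2)%Z; lia.
- by exists k; left; rewrite intrM; field.
by exists k; right; rewrite intrB intrM; field.
Qed.

(** Each line is paired with the edge midpoints on it; [slash I] is reached through the edge at
    [(I, I)], [backslash J] through the one at [(J - 1, J)]. *)
Lemma frieze_index_cases (n : nat) (P : array_index -> Prop) : (0 < n)%N ->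
  (forall I J : int, 0 <= J - I <= n%:Z -> P (point I J)) ->
  (forall I J : int, 0 <= J - I < n%:Z -> P (up_node I J) /\ P (slash I)) ->
  (forall I J : int, 0 < J - I <= n%:Z -> P (down_node I J) /\ P (backslash J)) ->
  forall x, frieze_index n x -> P x.
Proof.
move=> n0 hA hU hD [i j|i|j] /=; last 2 first.
- by case/half_oddP=> I ->; have [] := hU I I; rewrite ?subrr.
- case/half_oddP=> J ->; have [] := hD (J - 1) J; last by [].
  by have -> : J - (J - 1) = 1 by ring.
rewrite /is_node => /andP[/orP[]/andP[]].
- case/intrP=> I -> /int_or_halfP[J [->|->]] h.
    apply: hA; move: h; rewrite -intrB -[n%:R]/((n%:Z)%:~R) !ler_int ler0z //.
  have [] := hD I J; last by [].
  (* The half-integer bounds are relaxed to strict integer ones, which are equivalent for the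
     integer [J - I]. *)
  have : (0 : int)%:~R < (J - I)%:~R :> rat /\ (J - I)%:~R < (n%:Z + 1)%:~R :> rat.
    by rewrite intrB intrD -[(n%:Z)%:~R]/(n%:R); lra.
  by rewrite !ltr_int; lia.
case/int_or_halfP=> I [->|->] /intrP[J ->] h.
  apply: hA; move: h; rewrite -intrB -[n%:R]/((n%:Z)%:~R) !ler_int ler0z //.
have [] := hU I J; last by [].
have : (- 1 : int)%:~R < (J - I)%:~R :> rat /\ (J - I)%:~R < (n%:Z)%:~R :> rat.
  by rewrite intrB -[(n%:Z)%:~R]/(n%:R); lra.
by rewrite !ltr_int; lia.
Qed.

(** * Boundary rows and flips of a frieze *)

Section Frieze.

Context (R : realType) (n : nat) (n_gt1 : (1 < n)%N).
Context (z : array_index -> R[i]) (hz : heronian_frieze n z).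

Lemma frieze_diamond (I J : int) : 1 <= J - I <= n%:Z - 1 ->
  heronian_diamond (z (point I (J + 1))) (z (slash (I + 1)))
    (z (point (I + 1) J)) (z (backslash (J + 1))) (z (point I J))
    (z (point (I + 1) (J + 1))) (z (up_node (I + 1) J)) (z (down_node I (J + 1)))
    (z (up_node (I + 1) (J + 1))) (z (down_node (I + 1) (J + 1))).
Proof.
move=> h; have [/(_ I J h) /=] := hz.
rewrite /point /slash /backslash /up_node /down_node.
have half (K : int) : (K + 1)%:~R - 1 / 2 = K%:~R + 1 / 2 :> rat.
  by rewrite intrD; field.
by rewrite !half !intrD.
Qed.

Lemma frieze_border (I : int) :
  [/\ [/\ z (point I I) = 0, z (up_node I I) = 0 & z (down_node I (I + 1)) = 0],
      z (point I (I + n%:Z)) = 0, z (down_node I (I + n%:Z)) = 0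
    & z (up_node I (I + n%:Z - 1)) = 0].
Proof.
have n2 : 2 <= n%:R :> rat by rewrite (ler_nat _ 2).
have zero i j : (i \is a Num.int) && int_or_half j || int_or_half i && (j \is a Num.int) ->
    j - i \in [:: 0; 1 / 2; n%:R - 1 / 2; n%:R] -> z (Node i j) = 0.
  move=> hij hd; apply: hz.2 => //; rewrite /is_node hij /=.
  by move: hd; rewrite !inE => /or4P[] /eqP ->; lra.
split; [split | | |]; apply: zero;
  rewrite ?intr_int ?int_or_half_int ?int_or_half_half ?orbT //.
- by rewrite subrr inE eqxx.
- have -> : I%:~R - (I%:~R - 1 / 2) = 1 / 2 :> rat by ring.
  by rewrite !inE eqxx orbT.
- have -> : (I + 1)%:~R - 1 / 2 - I%:~R = 1 / 2 :> rat by rewrite intrD; field.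
  by rewrite !inE eqxx orbT.
- have -> : (I + n%:Z)%:~R - I%:~R = n%:R :> rat by rewrite intrD addrC addKr.
  by rewrite !inE eqxx !orbT.
- have -> : (I + n%:Z)%:~R - 1 / 2 - I%:~R = n%:R - 1 / 2 :> rat.
    by rewrite intrD -[(n%:Z)%:~R]/(n%:R); ring.
  by rewrite !inE eqxx !orbT.
have -> : (I + n%:Z - 1)%:~R - (I%:~R - 1 / 2) = n%:R - 1 / 2 :> rat.
  by rewrite intrB intrD -[(n%:Z)%:~R]/(n%:R); field.
by rewrite !inE eqxx !orbT.
Qed.

(** The point [(I, I + 1)] is the entry [e] of one bottom diamond, which gives the slash, and the
    entry [f] of the preceding one, which gives the backslash. *)
Lemma frieze_line_bottom (I : int) :
  z (slash (I + 1)) = z (point I (I + 1)) /\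
  z (backslash (I + 1)) = z (point I (I + 1)).
Proof.
have [[z1 z2 z3] _ _ _] := frieze_border (I + 1).
have [[_ _ z3'] _ _ _] := frieze_border I.
split.
  have h : 1 <= I + 1 - I <= n%:Z - 1 by lia.
  have := frieze_diamond h; have [[_ _ z4] _ _ _] := frieze_border (I + 1).
  by rewrite z1 z2 z4 => /diamond_bottom[].
have h : 1 <= I - (I - 1) <= n%:Z - 1 by lia.
have := frieze_diamond h; rewrite subrK.
have [[-> -> _] _ _ _] := frieze_border I.
by rewrite z3' => /diamond_bottom[].
Qed.

Lemma frieze_line_top (I : int) :
  z (slash I) = z (point I (I + n%:Z - 1)) /\
  z (backslash (I + n%:Z)) = z (point I (I + n%:Z - 1)).
Proof.
split.
  have h : 1 <= I + n%:Z - 2 - (I - 1) <= n%:Z - 1 by lia.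
  have := frieze_diamond h; rewrite subrK.
  have -> : I + n%:Z - 2 + 1 = I - 1 + n%:Z by ring.
  have [_ -> -> _] := frieze_border (I - 1).
  have -> : I - 1 + n%:Z = I + n%:Z - 1 by ring.
  have [_ _ _ ->] := frieze_border I.
  by move=> /diamond_top[].
have h : 1 <= I + n%:Z - 1 - I <= n%:Z - 1 by lia.
have := frieze_diamond h; rewrite subrK.
have [_ -> -> _] := frieze_border I.
have := frieze_border (I + 1).
have -> : I + 1 + n%:Z - 1 = I + n%:Z by ring.
by case=> _ _ _ -> /diamond_top[].
Qed.

(** Entries [e] and [f] lie in the same row, so off the two boundary rows both are nonzero. *)
Lemma frieze_flippable (hz0 : nonvanishing n z) (I J : int) :
  1 <= J - I <= n%:Z - 1 ->
  flippable (z (point I (J + 1))) (z (point (I + 1) J)) (z (point I J))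
    (z (point (I + 1) (J + 1))) (z (up_node (I + 1) J)) (z (down_node I (J + 1)))
    (z (up_node (I + 1) (J + 1))) (z (down_node (I + 1) (J + 1))).
Proof.
move=> h; have [k1|k1] := eqVneq (J - I) 1.
  have -> : J = I + 1 by lia.
  have [[-> -> ->] _ _ _] := frieze_border (I + 1).
  by constructor 2.
have [kn|kn] := eqVneq (J - I) (n%:Z - 1).
  have -> : J + 1 = I + n%:Z by lia.
  have [_ -> -> _] := frieze_border I.
  have [_ _ _] := frieze_border (I + 1).
  have -> : I + 1 + n%:Z - 1 = I + n%:Z by ring.
  by move=> ->; constructor 3.
by constructor 1; split; apply: hz0; lia.
Qed.

End Frieze.

(** Line values travel with the edges: [p] and [r] lie on the line of [b], and [q] and [s] on that
    of [d], so a flip carries them over unchanged. *)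
Lemma frieze_flip_closed (R : realType) (n : nat) (z z' : array_index -> R[i]) :
  (1 < n)%N -> heronian_frieze n z -> nonvanishing n z ->
  heronian_frieze n z' -> nonvanishing n z' ->
  flip_closed n%:Z (fun I J => z' (point I J) = z (point I J))
    (fun I J => z' (up_node I J) = z (up_node I J) /\ z' (slash I) = z (slash I))
    (fun I J => z' (down_node I J) = z (down_node I J) /\
                z' (backslash J) = z (backslash J)).
Proof.
move=> n1 hz hz0 hz' hz0'; split.
- move=> I J h e1 e2 e3 [e4 e5] [e6 e7].
  have := frieze_diamond hz' h; have := frieze_flippable n1 hz' hz0' h.
  rewrite e1 e2 e3 e4 e5 e6 e7 => fl' dia'.
  have := diamond_determined (frieze_flippable n1 hz hz0 h) fl'
    (frieze_diamond hz h) dia'.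
  by case=> -> -> ->.
- move=> I J h e1 e2 e3 [e4 e5] [e6 e7].
  have fl := frieze_flippable n1 hz hz0 h.
  have dia := diamond_flip fl (frieze_diamond hz h).
  have fl' := frieze_flippable n1 hz' hz0' h.
  have := diamond_flip fl' (frieze_diamond hz' h).
  move: fl' => /flippable_sym; rewrite e1 e2 e3 e4 e5 e6 e7 => fl' dia'.
  have := diamond_determined (flippable_sym fl) fl' dia dia'.
  by case=> -> -> ->.
- move=> I; have [[-> _ _] _ _ _] := frieze_border n1 hz I.
  by have [[-> _ _] _ _ _] := frieze_border n1 hz' I.
- move=> I; have [_ -> _ _] := frieze_border n1 hz I.
  by have [_ -> _ _] := frieze_border n1 hz' I.
- move=> I e; have [-> ->] := frieze_line_bottom n1 hz I.
  have [-> ->] := frieze_line_bottom n1 hz' I.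
  have [[_ _ ->] _ _ _] := frieze_border n1 hz I.
  have [[_ _ ->] _ _ _] := frieze_border n1 hz' I.
  have [[_ -> _] _ _ _] := frieze_border n1 hz (I + 1).
  by have [[_ -> _] _ _ _] := frieze_border n1 hz' (I + 1).
move=> I e; have [-> ->] := frieze_line_top n1 hz I.
have [-> ->] := frieze_line_top n1 hz' I.
have [_ _ -> ->] := frieze_border n1 hz I.
by have [_ _ -> ->] := frieze_border n1 hz' I.
Qed.

(** * From traversing paths to lattice paths, and the conclusion *)

(** The height [j - i] must gain [n - 2] in [2 * n - 4] steps of at most 1/2, so each step gains
    exactly 1/2. *)
Lemma traversing_path_lattice (n : nat) (i j : nat -> rat) (l : nat -> array_index) :
  (1 < n)%N -> traversing_path n i j l ->
  exists M : nat -> int,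
    (forall t, (0 < t < n)%N -> on_path n i j l (point (M t - t%:Z) (M t))) /\
    (forall t, (0 < t < n.-1)%N ->
       [/\ M t.+1 = M t, on_path n i j l (up_node (M t - t%:Z) (M t))
         & on_path n i j l (slash (M t - t%:Z))] \/
       [/\ M t.+1 = M t + 1, on_path n i j l (down_node (M t - t%:Z) (M t + 1))
         & on_path n i j l (backslash (M t + 1))]).
Proof.
move=> n1 [hin hl [h1 hend] hstep hline].
pose h k := j k - i k.
have hle k : (0 < k <= 2 * n - 4)%N -> h k.+1 <= h k + 1 / 2.
  move=> /hstep; rewrite /h.
  have := ler_norm (j k.+1 - j k); have := ler_norm (- (i k.+1 - i k)).
  by rewrite normrN; lra.
(* This quantity never increases and equals 1/2 at both ends of the path, hence is constant. *)
pose g k := h k - k%:R / 2.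
have gmono d a : (0 < a)%N -> (a + d <= 2 * n - 3)%N -> g (a + d)%N <= g a.
  elim: d => [|d IH] a0 had; first by rewrite addn0.
  have /hle : (0 < a + d <= 2 * n - 4)%N by lia.
  have := IH a0; have -> : (a + d <= 2 * n - 3)%N by lia.
  by move=> /(_ isT); rewrite /g addnS -[(a + d).+1%:R]natr1; lra.
have hE k : (0 < k <= 2 * n - 3)%N -> h k = 1 / 2 + k%:R / 2.
  move=> hk; have n3 : (n = (n - 2).+2)%N by lia.
  have := gmono (k - 1)%N 1%N isT; have := gmono (2 * n - 3 - k)%N k.
  have -> : (1 + (k - 1) = k)%N by lia.
  have -> : (k + (2 * n - 3 - k) = 2 * n - 3)%N by lia.
  have -> : (0 < k)%N by lia.
  have -> : (k <= 2 * n - 3)%N by lia.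
  move=> /(_ isT (leqnn _)) + /(_ isT).
  rewrite /g {1}/h hend {3}/h h1.
  have -> : (2 * n - 3)%:R = 2 * n%:R - 3 :> rat by rewrite natrB ?natrM; [|lia].
  by lra.
(* The increments satisfy [|di| + |dj| = dj - di], which forces [dj >= 0 >= di]. *)
have mono k : (0 < k <= 2 * n - 4)%N -> j k <= j k.+1 /\ i k.+1 <= i k.
  move=> hk; have := hstep k hk.
  have := hE k; have := hE k.+1; rewrite /h -[k.+1%:R]natr1 => e1 e2.
  have := ler_norm (j k.+1 - j k); have := ler_norm (- (i k.+1 - i k)).
  have := normr_ge0 (j k.+1 - j k); have := normr_ge0 (i k.+1 - i k).
  rewrite normrN; have := e1 ltac:(lia); have := e2 ltac:(lia); lra.
(* The odd-numbered nodes of the path are the integer points. *)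
pose M t := Num.floor (j (2 * t).-1).
have hM t : (0 < t < n)%N ->
    j (2 * t).-1 = (M t)%:~R /\ i (2 * t).-1 = (M t - t%:Z)%:~R.
  move=> ht; have hk : (0 < (2 * t).-1 <= 2 * n - 3)%N by lia.
  have e : j (2 * t).-1 - i (2 * t).-1 = (t%:Z)%:~R.
    have := hE _ hk; rewrite /h => ->.
    have -> : (2 * t).-1%:R = 2 * t%:R - 1 :> rat.
      by rewrite -subn1 natrB ?natrM; [|lia].
    by rewrite -[(t%:Z)%:~R]/(t%:R); lra.
  (* One coordinate of a node is an integer, and here so is their difference. *)
  have [J eJ] : exists J : int, j (2 * t).-1 = J%:~R.
    have /andP[/andP[+ _] _] := hin _ hk; case/orP=> /andP[].
      move=> /intrP[I eI] _; exists (I + t%:Z).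
      by rewrite intrD -eI -e; ring.
    by move=> _ /intrP.
  rewrite /M eJ intrKfloor; split=> //.
  by rewrite intrB -e eJ; ring.
exists M; split=> t ht.
  have [e1 e2] := hM t ht; left; exists (2 * t).-1; first by lia.
  by rewrite /point -e1 -e2.
have [e1 e2] : j (2 * t).-1 = (M t)%:~R /\ i (2 * t).-1 = (M t - t%:Z)%:~R.
  by apply: hM; lia.
have [e3 e4] : j (2 * t).+1 = (M t.+1)%:~R /\ i (2 * t).+1 = (M t.+1 - t.+1%:Z)%:~R.
  have := hM t.+1; have -> : ((2 * t.+1).-1 = (2 * t).+1)%N by lia.
  by apply; lia.
have hS : ((2 * t).-1.+1 = 2 * t)%N by lia.
have [] := mono (2 * t).-1; first lia; have [] := mono (2 * t)%N; first lia.
rewrite hS e1 e2 e3 e4 => m1 m2 m3 m4.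
have := le_trans m3 m1; have := le_trans m2 m4; rewrite !ler_int => m5 m6.
have := hE (2 * t)%N; rewrite /h natrM => hmid.
have {}hmid : j (2 * t)%N - i (2 * t)%N = 1 / 2 + t%:R by rewrite hmid; [field|lia].
have [l1 l2] : (half_odd (i (2 * t)%N) -> l t = Slash (i (2 * t)%N)) /\
    (half_odd (j (2 * t)%N) -> l t = Backslash (j (2 * t)%N)).
  by apply: hline; lia.
have pN : on_path n i j l (Node (i (2 * t)%N) (j (2 * t)%N)).
  by left; exists (2 * t)%N => //; lia.
have pl : on_path n i j l (l t) by right; exists t => //; lia.
(* In each case one coordinate agrees at both odd nodes, so monotonicity fixes it at the middle node
   and the height gives the other. *)
have [eM|eM] : M t.+1 = M t \/ M t.+1 = M t + 1 by lia.
  left; have ej : j (2 * t)%N = (M t)%:~R.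
    by apply/le_anti; rewrite m3 andbT -[in X in _ <= X]eM.
  have ei : i (2 * t)%N = (M t - t%:Z)%:~R - 1 / 2.
    by rewrite intrB -ej -[(t%:Z)%:~R]/(t%:R); lra.
  split=> //; first by rewrite /up_node -ei -ej.
  by rewrite /slash -ei -l1 // ei half_odd_int_subr.
right; have ei : i (2 * t)%N = (M t - t%:Z)%:~R.
  apply/le_anti; rewrite m4 /=; move: m2; rewrite eM.
  by have -> : M t + 1 - t.+1%:Z = M t - t%:Z by lia.
have ej : j (2 * t)%N = (M t + 1)%:~R - 1 / 2.
  move: ei; rewrite intrB intrD -[(t%:Z)%:~R]/(t%:R); lra.
split=> //; first by rewrite /down_node -ei -ej.
by rewrite /backslash -ej -l2 // ej half_odd_int_subr.
Qed.

Theorem corollary3p10 (R : realType) (n : nat) (hn : (4 <= n)%N)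
    (z : array_index -> R[i]) (hz : heronian_frieze n z) (hz0 : nonvanishing n z)
    (i j : nat -> rat) (l : nat -> array_index) (hpi : traversing_path n i j l)
    (z' : array_index -> R[i]) (hz' : heronian_frieze n z')
    (hz'0 : nonvanishing n z')
    (hzz' : forall x : array_index, on_path n i j l x -> z' x = z x) :
  forall x : array_index, frieze_index n x -> z' x = z x.
Proof.
have n1 : (1 < n)%N by lia.
have fc := frieze_flip_closed n1 hz hz0 hz' hz'0.
have [M [MP ME]] := traversing_path_lattice n1 hpi.
(* The path is prolonged to the rows 0 and n by repeating its end values. *)
pose m (k : int) := M (minn n.-1 (maxn 1 (absz k))).
have mE (t : nat) : (0 < t < n)%N -> m t = M t.
  by move=> ht; rewrite /m absz_nat; congr M; lia.
have m0 : m 0 = M 1%N by rewrite /m; congr M; lia.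
have mn : m n%:Z = M n.-1 by rewrite /m absz_nat; congr M; lia.
have lp : lattice_path n%:Z (fun I J => z' (point I J) = z (point I J))
    (fun I J => z' (up_node I J) = z (up_node I J) /\ z' (slash I) = z (slash I))
    (fun I J => z' (down_node I J) = z (down_node I J) /\
                z' (backslash J) = z (backslash J)) m.
  split=> k hk; have [t ek] : exists t : nat, k = t by exists (absz k); lia.
    subst k; have [t0|t0] := eqVneq t 0%N.
      by rewrite t0 subr0; apply: (border0 fc).
    have [tn|tn] := eqVneq t n.
      by have := bordern fc (m n - n%:Z); rewrite subrK tn.
    by rewrite mE; [apply/hzz'/MP|]; lia.
  subst k; have -> : t%:Z + 1 = t.+1%:Z by lia.
  (* The two added steps keep [m] constant, so they run along [U] edges, which the border clauses
     supply from the first and last points of the path. *)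
  have [t0|t0] := eqVneq t 0%N.
    subst t; left; rewrite subr0 m0 mE; last by lia.
    split=> //; have := @border1 _ _ _ _ fc (M 1%N - 1); rewrite subrK => h.
    by apply: (h _).1; apply/hzz'/MP; lia.
  have [tn|tn] := eqVneq t n.-1.
    have -> : t.+1 = n by lia.
    left; rewrite mn mE; last by lia.
    rewrite -tn; split=> //; have := @bordern1 _ _ _ _ fc (M t - t%:Z).
    have -> : M t - t%:Z + n%:Z - 1 = M t by lia.
    by move=> h; apply: (h _).1; apply/hzz'/MP; lia.
  rewrite !mE; [|lia..].
  have [|[e1 e2 e3]|[e1 e2 e3]] := ME t; first by lia.
    by left; split; last by split; apply: hzz'.
  by right; split; last by split; apply: hzz'.
have nZ : 1 < n%:Z by lia.
have [hA hU hD] := flip_closed_path_full nZ fc lp.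
by apply: frieze_index_cases => //; lia.
Qed.
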